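(* Let \[ C_1=\frac{x^2(t_1-1)}{1-x^2(t_1-1)(t_2-1)},\quad C_2=\frac{x^2(t_2-1)}{1-x^2(t_1-1)(t_2-1)},\quad C_3=\frac{x^3(t_1-1)(t_2-1)}{1-x^2(t_1-1)(t_2-1)}, \] and let $\{R_m\}_{m\ge0}$ be the rational functions in $x,t_1,t_2$ defined by $R_0=1$, $R_1=1-x-C_2$, and \[ R_m=(1-x-C_1-C_2)R_{m-1}-(x+C_3)^2R_{m-2}\quad(m\ge2). \] Then for $m\ge1$, \[ F_m^{\mathrm{p,v}}(x,t_1,t_2)=\frac{R_m}{(1-x-C_1)R_m-(x+C_3)^2R_{m-1}} =\cfrac{1}{1-x-C_1-\cfrac{(x+C_3)^2}{1-x-C_1-C_2-\cfrac{(x+C_3)^2}{\ddots\;-\cfrac{(x+C_3)^2}{1-x-C_2}}}}, \] a continued fraction with $m+1$ fraction bars in which the denominator $1-x-C_1-C_2$ appears $m-1$ times, and \[ F^{\mathrm{p,v}}(x,t_1,t_2)=\cfrac{1}{1-x-C_1-\cfrac{(x+C_3)^2}{1-x-C_1-C_2-\cfrac{(x+C_3)^2}{1-x-C_1-C_2-\cdots}}}=\frac{2}{1-x-C_1+C_2+\sqrt{(1-x-C_1-C_2)^2-4(x+C_3)^2}}. \]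
   Context: A Motzkin path of length $n$ is a sequence of $n$ steps $U$ ($+1$), $F$ ($0$), $D$ ($-1$) starting and ending at height $0$ and never going below $0$; it has height bounded by $m$ if all heights are at most $m$. A peak is an occurrence of the consecutive subword $UD$ and a valley an occurrence of $DU$; $\mathrm{peak}\,\mu$ and $\mathrm{val}\,\mu$ are their numbers in $\mu$. With $\mathcal{M}_n^m$ the Motzkin paths of length $n$ with height bounded by $m$ and $\mathcal{M}_n$ all Motzkin paths of length $n$, $F_m^{\mathrm{p,v}}(x,t_1,t_2)=\sum_n\sum_{\mu\in\mathcal{M}_n^m}t_1^{\mathrm{peak}\,\mu}t_2^{\mathrm{val}\,\mu}x^n$ and $F^{\mathrm{p,v}}(x,t_1,t_2)=\sum_n\sum_{\mu\in\mathcal{M}_n}t_1^{\mathrm{peak}\,\mu}t_2^{\mathrm{val}\,\mu}x^n$. An infinite continued fraction denotes the formal power series limit of its finite truncations. *)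

(* Defs.v *)
From HB Require Import structures.
From mathcomp Require Import all_boot all_order all_algebra.
From mathcomp Require Import boolp classical_sets.
From mathcomp Require Import mpoly.

Set Implicit Arguments.
Unset Strict Implicit.
Unset Printing Implicit Defensive.

Import GRing.Theory.
Local Open Scope ring_scope.

Record fps (R : Type) := Fps { fcoef : nat -> R }.

HB.instance Definition _ (R : Type) := gen_eqMixin (fps R).
HB.instance Definition _ (R : Type) := gen_choiceMixin (fps R).

Lemma fpsP (R : Type) (f g : fps R) : fcoef f =1 fcoef g -> f = g.
Proof. by case: f g => [f] [g] /= /funext ->. Qed.

Section FpsZmod.
Variable R : nzRingType.
Implicit Types f g h : fps R.

Definition fps0 : fps R := Fps (fun=> 0).
Definition fps_opp f : fps R := Fps (fun n => - fcoef f n).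
Definition fps_add f g : fps R := Fps (fun n => fcoef f n + fcoef g n).

Lemma fps_addA : associative fps_add.
Proof. by move=> f g h; apply: fpsP => n /=; rewrite addrA. Qed.
Lemma fps_addC : commutative fps_add.
Proof. by move=> f g; apply: fpsP => n /=; rewrite addrC. Qed.
Lemma fps_add0 : left_id fps0 fps_add.
Proof. by move=> f; apply: fpsP => n /=; rewrite add0r. Qed.
Lemma fps_addN : left_inverse fps0 fps_opp fps_add.
Proof. by move=> f; apply: fpsP => n /=; rewrite addNr. Qed.

HB.instance Definition _ :=
  GRing.isZmodule.Build (fps R) fps_addA fps_addC fps_add0 fps_addN.

Lemma fcoefD f g n : fcoef (f + g) n = fcoef f n + fcoef g n.
Proof. by []. Qed.
Lemma fcoefN f n : fcoef (- f) n = - fcoef f n.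
Proof. by []. Qed.
Lemma fcoef0 n : fcoef (0 : fps R) n = 0.
Proof. by []. Qed.

End FpsZmod.

Section FpsRing.
Variable R : comNzRingType.
Implicit Types f g h : fps R.

Definition fps1 : fps R := Fps (fun n => (n == 0%N)%:R).
Definition fps_mul f g : fps R :=
  Fps (fun n => \sum_(i < n.+1) fcoef f i * fcoef g (n - i)%N).

Let trunc N f : {poly R} := \poly_(i < N) fcoef f i.

Let coef_trunc N f i : (i < N)%N -> (trunc N f)`_i = fcoef f i.
Proof. by move=> iN; rewrite coef_poly iN. Qed.

Let fps_mul_trunc N f g n : (n < N)%N ->
  fcoef (fps_mul f g) n = (trunc N f * trunc N g)`_n.
Proof.
move=> nN; rewrite coefM /=; apply: eq_bigr => i _.
by rewrite !coef_trunc ?(leq_ltn_trans _ nN) ?leq_subr // -ltnS ltn_ord.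
Qed.

Lemma fps_mulC : commutative fps_mul.
Proof.
by move=> f g; apply: fpsP => n; rewrite !(@fps_mul_trunc n.+1) // mulrC.
Qed.

Lemma fps_mulA : associative fps_mul.
Proof.
have mulr3 f g h n : fcoef (fps_mul f (fps_mul g h)) n =
    (trunc n.+1 f * (trunc n.+1 g * trunc n.+1 h))`_n.
  rewrite coefM; apply: eq_bigr => i _.
  by rewrite coef_trunc ?ltn_ord // (@fps_mul_trunc n.+1) // ltnS leq_subr.
move=> f g h; apply: fpsP => n; rewrite [fps_mul (fps_mul f g) h]fps_mulC.
by rewrite !mulr3 mulrCA mulrC -mulrA mulrCA [_ * trunc _ g]mulrC mulrCA.
Qed.

Lemma fps_mul1 : left_id fps1 fps_mul.
Proof.
move=> f; apply: fpsP => n /=.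
by rewrite big_ord_recl /= mul1r subn0 big1 ?addr0 // => i _; rewrite mul0r.
Qed.

Lemma fps_mulDl : left_distributive fps_mul +%R.
Proof.
move=> f g h; apply: fpsP => n /=; rewrite -big_split /=.
by apply: eq_bigr => i _; rewrite mulrDl.
Qed.

Lemma fps1_neq0 : fps1 != 0.
Proof.
by apply/eqP => /(congr1 (@fcoef R))/(congr1 (@^~ 0%N))/eqP; rewrite oner_eq0.
Qed.

HB.instance Definition _ := GRing.Zmodule_isComNzRing.Build (fps R)
  fps_mulA fps_mulC fps_mul1 fps_mulDl fps1_neq0.

Lemma fcoef1 n : fcoef (1 : fps R) n = (n == 0%N)%:R.
Proof. by []. Qed.
Lemma fcoefM f g n :
  fcoef (f * g) n = \sum_(i < n.+1) fcoef f i * fcoef g (n - i)%N.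
Proof. by []. Qed.

Definition fps_of_poly (p : {poly R}) : fps R := Fps (fun n => p`_n).

Definition fps_cvg (u : nat -> fps R) (f : fps R) : Prop :=
  forall k, exists N, forall n, (N <= n)%N -> fcoef (u n) k = fcoef f k.

(* The square root is the root with constant term 1, the usual branch for
   series with constant term 1. *)
Definition fps_sqrt f : fps R :=
  xget 0 [set g | fcoef g 0 = 1 /\ g ^+ 2 = f].

End FpsRing.

Section FpsUnit.
Variable R : comUnitRingType.
Implicit Types f g : fps R.

Definition fps_unit : {pred fps R} := fun f => fcoef f 0 \is a GRing.unit.

(* The first n coefficients of 1 / f, in reverse order. *)
Fixpoint fps_inv_rec f n : seq R :=
  if n is n'.+1 then
    let s := fps_inv_rec f n' in
    (fcoef f 0)^-1 * ((n' == 0%N)%:R - \sum_(i < n') fcoef f i.+1 * s`_i) :: s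
  else [::].

Definition fps_inv f : fps R :=
  if f \in fps_unit then Fps (fun n => (fps_inv_rec f n.+1)`_0) else f.

Lemma fps_inv_rec_nth f n i : (i < n)%N ->
  (fps_inv_rec f n)`_i = (fps_inv_rec f (n - i))`_0.
Proof.
elim: n i => // n IHn [|i] //; rewrite ltnS subSS => /IHn <-; by [].
Qed.

Lemma fps_mulV : {in fps_unit, left_inverse 1 fps_inv *%R}.
Proof.
move=> f fU; rewrite /fps_inv fU mulrC; apply: fpsP => n.
rewrite fcoefM big_ord_recl /= subn0 mulVKr //.
rewrite [X in _ + X](_ : _ =
  \sum_(i < n) fcoef f i.+1 * (fps_inv_rec f n)`_i) ?subrK //.
apply: eq_bigr => i _; rewrite [in RHS]fps_inv_rec_nth //.
by rewrite -(subnSK (ltn_ord i)).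
Qed.

Lemma fps_unitPl f g : g * f = 1 -> f \in fps_unit.
Proof.
move=> /(congr1 (@fcoef R))/(congr1 (@^~ 0%N)).
rewrite fcoefM big_ord1 subn0 /= => gf1.
by apply/unitrP; exists (fcoef g 0); rewrite [_ * fcoef g 0]mulrC.
Qed.

Lemma fps_inv_out : {in [predC fps_unit], fps_inv =1 id}.
Proof. by move=> f; rewrite inE /= /fps_inv => /negbTE ->. Qed.

HB.instance Definition _ := GRing.ComNzRing_hasMulInverse.Build (fps R)
  fps_mulV fps_unitPl fps_inv_out.

End FpsUnit.

Section FpsDomain.
Variable R : idomainType.

Lemma fps_integral : GRing.integral_domain_axiom (fps R).
Proof.
move=> f g fg0; apply/norP => -[f0 g0].
have ord (h : fps R) : h != 0 -> exists2 n, fcoef h n != 0 &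
    forall i, (i < n)%N -> fcoef h i = 0.
  move=> h0; have /ex_minnP[n hn nmin] : exists n, fcoef h n != 0.
    by apply: contrapT => H; case/eqP: h0; apply: fpsP => n; apply/eqP;
      apply: contrapT => /negP hn; apply: H; exists n.
  exists n => // i; apply: contraTeq => /nmin; by rewrite -leqNgt.
have [[n fn fmin] [m gm gmin]] := (ord f f0, ord g g0).
move/(congr1 (@fcoef R))/(congr1 (@^~ (n + m)%N)) : fg0.
have lt_n : (n < (n + m).+1)%N by rewrite ltnS leq_addr.
rewrite /= (bigD1 (Ordinal lt_n)) //= big1 ?addr0 => [|i in_].
  by rewrite addKn => /eqP; rewrite mulf_eq0 (negbTE fn) (negbTE gm).
have [/fmin ->|] := ltnP i n; first by rewrite mul0r.
rewrite leq_eqVlt eq_sym -[_ == n :> nat]/(i == Ordinal lt_n) (negbTE in_) /=.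
move=> lt_ni; rewrite gmin ?mulr0 // ltn_subLR 1?ltn_add2r //.
by rewrite -ltnS.
Qed.

HB.instance Definition _ :=
  GRing.ComUnitRing_isIntegral.Build (fps R) fps_integral.

(* The power series expansion at x = 0 of a rational function in x (0 if it
   has none): r = p / q expands to f when q f = p. *)
Definition expand (r : {fraction {poly R}}) : fps R :=
  xget 0 [set f | exists p q : {poly R},
    [/\ q != 0, r = tofrac p / tofrac q &
        f * fps_of_poly q = fps_of_poly p]].

Lemma fps_of_polyM (p q : {poly R}) :
  fps_of_poly (p * q) = fps_of_poly p * fps_of_poly q.
Proof. by apply: fpsP => n; rewrite fcoefM /= coefM. Qed.

Lemma fps_of_poly_eq0 (p : {poly R}) : (fps_of_poly p == 0) = (p == 0).
Proof.
apply/eqP/eqP => [p0|->]; last by apply: fpsP => n; rewrite /= coef0.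
apply/polyP => n; rewrite coef0.
by have := congr1 (@^~ n) (congr1 (@fcoef R) p0).
Qed.

Lemma expandE (p q : {poly R}) (f : fps R) : q != 0 ->
  f * fps_of_poly q = fps_of_poly p -> expand (tofrac p / tofrac q) = f.
Proof.
move=> q0 fE; apply: xget_unique => [|g [p' [q' [q'0 rE gE]]]].
  by exists p, q.
have pq : p * q' = p' * q.
  apply/eqP; rewrite -tofrac_eq !tofracM -eqr_div ?tofrac_eq0 //.
  exact/eqP.
apply/eqP; rewrite -subr_eq0.
have nz : fps_of_poly q * fps_of_poly q' != 0.
  by rewrite mulf_neq0 // fps_of_poly_eq0.
rewrite -(mulrI_eq0 _ (mulfI nz)) mulrBr subr_eq0; apply/eqP.
rewrite -mulrA [_ * g]mulrC gE mulrAC [_ * f]mulrC fE.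
by rewrite [LHS]mulrC -!fps_of_polyM pq.
Qed.

Lemma fps_sqrtE (f g : fps R) : 2%:R != 0 :> R ->
  fcoef g 0 = 1 -> g ^+ 2 = f -> fps_sqrt f = g.
Proof.
move=> two0 g1 gE; apply: xget_unique => // h [h1 hE].
have /eqP : h ^+ 2 = g ^+ 2 by rewrite hE.
rewrite eqf_sqr => /orP[/eqP //|/eqP hg]; case/eqP: two0.
by rewrite mulr2n -{1}h1 hg fcoefN g1 addNr.
Qed.

End FpsDomain.

Inductive step := Up | Flat | Down.

Definition step_code (s : step) : 'I_3 :=
  match s with Up => inord 0 | Flat => inord 1 | Down => inord 2 end.
Definition step_decode (i : 'I_3) : step :=
  match nat_of_ord i with 0%N => Up | 1%N => Flat | _ => Down end.
Lemma step_codeK : cancel step_code step_decode.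
Proof. by case; rewrite /step_decode /= inordK. Qed.

HB.instance Definition _ := Equality.copy step (can_type step_codeK).
HB.instance Definition _ := Choice.copy step (can_type step_codeK).
HB.instance Definition _ := Countable.copy step (can_type step_codeK).
HB.instance Definition _ := Finite.copy step (can_type step_codeK).

Definition step_val (s : step) : int :=
  match s with Up => 1 | Flat => 0 | Down => -1 end.

Definition height (w : seq step) (k : nat) : int :=
  \sum_(s <- take k w) step_val s.

Definition motzkin (w : seq step) : bool :=
  (height w (size w) == 0) &&
  [forall k : 'I_(size w).+1, (0 <= height w k)%R].

Definition height_le (m : nat) (w : seq step) : bool :=
  [forall k : 'I_(size w).+1, (height w k <= m%:Z)%R].

Definition occ2 (a b : step) (w : seq step) : nat :=
  count_mem (a, b) (zip w (behead w)).
Definition peak (w : seq step) : nat := occ2 Up Down w.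
Definition valley (w : seq step) : nat := occ2 Down Up w.

(* The coefficient ring Q[t1, t2], with t1 = 'X_0 and t2 = 'X_1, and the
   field Q(x, t1, t2), presented as the fractions of Q[t1, t2][x]. *)
Definition Qt : idomainType := {mpoly rat[2]}.
Definition Qxt : fieldType := {fraction {poly Qt}}.

Definition t1_ : Qt := 'X_(inord 0 : 'I_2).
Definition t2_ : Qt := 'X_(inord 1 : 'I_2).

Definition motzkin_paths (n : nat) : {set n.-tuple step} :=
  [set w : n.-tuple step | motzkin w].
Definition motzkin_paths_le (m n : nat) : {set n.-tuple step} :=
  [set w : n.-tuple step | motzkin w && height_le m w].

Definition Fpv_le (m : nat) : fps Qt :=
  Fps (fun n => \sum_(w in motzkin_paths_le m n)
                   t1_ ^+ peak w * t2_ ^+ valley w).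
Definition Fpv : fps Qt :=
  Fps (fun n => \sum_(w in motzkin_paths n) t1_ ^+ peak w * t2_ ^+ valley w).

Definition x : Qxt := tofrac ('X : {poly Qt}).
Definition t1 : Qxt := tofrac (t1_%:P : {poly Qt}).
Definition t2 : Qxt := tofrac (t2_%:P : {poly Qt}).

Definition C1 : Qxt :=
  (x ^+ 2 * (t1 - 1)) / (1 - x ^+ 2 * (t1 - 1) * (t2 - 1)).
Definition C2 : Qxt :=
  (x ^+ 2 * (t2 - 1)) / (1 - x ^+ 2 * (t1 - 1) * (t2 - 1)).
Definition C3 : Qxt :=
  (x ^+ 3 * (t1 - 1) * (t2 - 1)) / (1 - x ^+ 2 * (t1 - 1) * (t2 - 1)).

Fixpoint R_ (m : nat) : Qxt :=
  match m with
  | 0 => 1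
  | m1.+1 =>
    match m1 with
    | 0 => 1 - x - C2
    | m2.+1 => (1 - x - C1 - C2) * R_ m1 - (x + C3) ^+ 2 * R_ m2
    end
  end.

(* contfrac [:: (b1, a1); ...; (bn, an)] is b1 / (a1 - b2 / (a2 - ... - bn / an)). *)
Definition contfrac (K : fieldType) (s : seq (K * K)) : K :=
  foldr (fun ba r => ba.1 / (ba.2 - r)) 0 s.

(* Main.v *)
Require Import Defs.
From mathcomp Require Import all_boot all_order all_algebra.
From mathcomp Require Import boolp classical_sets.
From mathcomp Require Import mpoly ring zify.

Set Implicit Arguments.
Unset Strict Implicit.
Unset Printing Implicit Defensive.

Import GRing.Theory.
Local Open Scope ring_scope.

(** A Motzkin path is a sequence of flat steps and arches in which consecutive
    arches form a valley, so the generating function A_k of the paths of height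
    at most k satisfies A_k = 1 / (1 - x - a_k / (1 - (t2 - 1) a_k)), where
    a_0 = 0 and a_(k+1) = x^2 (A_k + t1 - 1) counts the arches.  Instead of
    decomposing paths bijectively, we let the walks from height h to 0 that
    follow a step s be counted by series W_(h,s); reading off the first step
    gives a linear system that determines these series, and a product of
    first-passage series built from the A_k is checked to solve it.

    The homography sending A_k to A_(k+1) can be rewritten as
    1/A_(k+1) = 1 - x - C1 - (x + C3)^2 / (1/A_k - C2), because x + C3 equals
    x / (1 - x^2 (t1-1) (t2-1)); iterating it gives the continued fraction.
    Modulo x^n the unbounded series F agrees with A_n, so F is the fixed point
    of this map, and T = 1/F - C2 is a root of
    T^2 - (1 - x - C1 - C2) T + (x + C3)^2 with constant term 1. *)

(** * Formal power series *)

Section SeriesOps.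
Variable R : comUnitRingType.
Implicit Types f g h : fps R.

Definition fpsX : fps R := fps_of_poly 'X.
Definition fpsC (c : R) : fps R := fps_of_poly c%:P.

Lemma fcoef_ext f g : f = g -> fcoef f =1 fcoef g.
Proof. by move->. Qed.

Lemma fcoefM0 f g : fcoef (f * g) 0 = fcoef f 0 * fcoef g 0.
Proof. by rewrite fcoefM big_ord1. Qed.

Lemma fcoefXM0 f : fcoef (fpsX * f) 0 = 0.
Proof. by rewrite fcoefM0 /= coefX mul0r. Qed.

Lemma fcoefXMS f n : fcoef (fpsX * f) n.+1 = fcoef f n.
Proof.
rewrite fcoefM 2!big_ord_recl /= !coefX /= mul0r add0r mul1r subSS subn0.
by rewrite big1 ?addr0 // => i _; rewrite coefX mul0r.
Qed.

Lemma fcoefCM c f n : fcoef (fpsC c * f) n = c * fcoef f n.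
Proof.
rewrite fcoefM big_ord_recl /= coefC subn0 big1 ?addr0 // => i _.
by rewrite coefC mul0r.
Qed.

Lemma fpsC1 : fpsC 1 = 1.
Proof. by apply: fpsP => n; rewrite /= coef1. Qed.

Lemma fps_unitE f : (f \is a GRing.unit) = (fcoef f 0 \is a GRing.unit).
Proof. by []. Qed.

Lemma unit_fcoef1 f : fcoef f 0 = 1 -> f \is a GRing.unit.
Proof. by rewrite fps_unitE => ->; apply: unitr1. Qed.

Lemma fcoefV1 f : fcoef f 0 = 1 -> fcoef f^-1 0 = 1.
Proof.
move=> f1; have /fcoef_ext/(_ 0%N) := mulVr (unit_fcoef1 f1).
by rewrite fcoefM0 f1 mulr1.
Qed.

Definition eqmodX n f g := forall k, (k < n)%N -> fcoef f k = fcoef g k.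

Lemma eqmodX_eq f g : (forall n, eqmodX n f g) -> f = g.
Proof. by move=> fg; apply: fpsP => n; apply: (fg n.+1). Qed.

Lemma eqmodXB n f f' g g' :
  eqmodX n f f' -> eqmodX n g g' -> eqmodX n (f - g) (f' - g').
Proof. by move=> ff gg k kn; rewrite !fcoefD !fcoefN ff ?gg. Qed.

Lemma eqmodXM n f f' g g' :
  eqmodX n f f' -> eqmodX n g g' -> eqmodX n (f * g) (f' * g').
Proof.
move=> ff gg k kn; rewrite !fcoefM; apply: eq_bigr => i _.
rewrite ff ?gg // (leq_ltn_trans _ kn) ?leq_subr //.
by rewrite -ltnS.
Qed.

(** Both inverses are multiples of [f^-1 * g^-1], with cofactors [g] and [f]. *)
Lemma eqmodXV n f g : f \is a GRing.unit -> g \is a GRing.unit ->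
  eqmodX n f g -> eqmodX n f^-1 g^-1.
Proof.
move=> fU gU fg.
have fE : f^-1 = f^-1 * g^-1 * g by rewrite mulrVK.
have gE : g^-1 = f^-1 * g^-1 * f by rewrite mulrAC mulVr ?mul1r.
rewrite [X in eqmodX _ X]fE [X in eqmodX _ _ X]gE.
by apply: eqmodXM => // k /fg.
Qed.

(** The source of convergence: each level of the continued fraction carries a factor [X] and so
    gains one correct coefficient. *)
Lemma eqmodX_shift n f g : eqmodX n f g -> eqmodX n.+1 (fpsX * f) (fpsX * g).
Proof.
move=> fg [|k]; first by rewrite !fcoefXM0.
by rewrite ltnS !fcoefXMS => /fg.
Qed.

End SeriesOps.

Arguments fpsX {R}.

(** * Expansion of rational functions *)

Section Expansion.
Variable R : idomainType.
Implicit Types (r : {fraction {poly R}}) (f g : fps R).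

(** The relation from which [expand] chooses. It is compatible with the field operations, so an
    expansion can be built along the shape of the rational function. *)
Definition expands r f := exists p q : {poly R},
  [/\ q != 0, r = tofrac p / tofrac q & f * fps_of_poly q = fps_of_poly p].

Lemma expands_expand r f : expands r f -> expand r = f.
Proof. by move=> [p [q [q0 -> fE]]]; apply: expandE. Qed.

Lemma expands_neq0 r f : expands r f -> f != 0 -> r != 0.
Proof.
move=> [p [q [q0 -> fE]]] f0; rewrite mulf_neq0 ?invr_eq0 ?tofrac_eq0 //.
by rewrite -fps_of_poly_eq0 -fE mulf_neq0 ?fps_of_poly_eq0.
Qed.

Lemma fps_of_polyD (p q : {poly R}) :
  fps_of_poly (p + q) = fps_of_poly p + fps_of_poly q.
Proof. by apply: fpsP => n; rewrite /= coefD. Qed.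

Lemma fps_of_polyN (p : {poly R}) : fps_of_poly (- p) = - fps_of_poly p.
Proof. by apply: fpsP => n; rewrite /= coefN. Qed.

Lemma expands_tofrac (p : {poly R}) : expands (tofrac p) (fps_of_poly p).
Proof.
exists p, 1; rewrite oner_neq0 rmorph1 divr1; split=> //.
by rewrite -fps_of_polyM mulr1.
Qed.

Lemma expands1 : expands 1 1.
Proof.
have := expands_tofrac 1; rewrite rmorph1 (_ : fps_of_poly 1 = 1) //.
by apply: fpsP => n; rewrite /= coef1.
Qed.

Lemma expands0 : expands 0 0.
Proof.
have := expands_tofrac 0; rewrite rmorph0 (_ : fps_of_poly 0 = 0) //.
by apply/eqP; rewrite fps_of_poly_eq0.
Qed.

Lemma expandsN r f : expands r f -> expands (- r) (- f).
Proof.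
move=> [p [q [q0 -> fE]]]; exists (- p), q.
by rewrite rmorphN mulNr fps_of_polyN -fE mulNr.
Qed.

Lemma expandsD r f r' f' : expands r f -> expands r' f' ->
  expands (r + r') (f + f').
Proof.
move=> [p [q [q0 -> fE]]] [p' [q' [q'0 -> fE']]].
exists (p * q' + p' * q), (q * q'); split; first exact: mulf_neq0.
  by rewrite addf_div ?tofrac_eq0 // rmorphD !rmorphM.
rewrite fps_of_polyD !fps_of_polyM -fE -fE'; ring.
Qed.

Lemma expandsB r f r' f' : expands r f -> expands r' f' ->
  expands (r - r') (f - f').
Proof. by move=> rf /expandsN; apply: expandsD. Qed.

Lemma expandsM r f r' f' : expands r f -> expands r' f' ->
  expands (r * r') (f * f').
Proof.
move=> [p [q [q0 -> fE]]] [p' [q' [q'0 -> fE']]].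
exists (p * p'), (q * q'); split; first exact: mulf_neq0.
  by rewrite mulf_div !rmorphM.
by rewrite !fps_of_polyM -fE -fE' mulrACA.
Qed.

Lemma expandsX r f n : expands r f -> expands (r ^+ n) (f ^+ n).
Proof.
move=> rf; elim: n => [|n IHn]; first exact: expands1.
by rewrite !exprS; apply: expandsM.
Qed.

Lemma expands_nat n : expands n%:R n%:R.
Proof.
elim: n => [|n IHn]; first exact: expands0.
by rewrite -!natr1; apply/expandsD/expands1.
Qed.

Lemma expandsV r f : f \is a GRing.unit -> expands r f -> expands r^-1 f^-1.
Proof.
move=> fU [p [q [q0 -> fE]]]; exists q, p; split.
- rewrite -fps_of_poly_eq0 -fE mulf_neq0 ?fps_of_poly_eq0 //.
  by apply: contraTneq fU => ->; rewrite unitr0.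
- by rewrite invf_div.
- by rewrite -fE mulKr.
Qed.

End Expansion.

(** * Walks between two barriers *)

(** Unfolds on the first step, as the recurrence [walk_sumS] requires. The bound [m] is tested only
    when going up, so it is meaningful for a start [h <= m]. *)
Fixpoint walk_le (m h : nat) (w : seq step) : bool :=
  match w with
  | [::] => h == 0%N
  | Up :: w' => (h < m)%N && walk_le m h.+1 w'
  | Flat :: w' => walk_le m h w'
  | Down :: w' => if h is h'.+1 then walk_le m h' w' else false
  end.

Lemma height_cons s w k : height (s :: w) k.+1 = step_val s + height w k.
Proof. by rewrite /height /= big_cons. Qed.

Lemma height0 w : height w 0 = 0.
Proof. by rewrite /height take0 big_nil. Qed.

Lemma forall_heightP (P : pred int) w :
  reflect (forall k, (k <= size w)%N -> P (height w k))
          [forall k : 'I_(size w).+1, P (height w k)].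
Proof.
apply: (iffP forallP) => [H k kw | H k]; last by apply: H; rewrite -ltnS.
by have := H (Ordinal (kw : (k < (size w).+1)%N)).
Qed.

Lemma walk_leP m h w : (h <= m)%N ->
  reflect (h%:Z + height w (size w) = 0 /\
           forall k, (k <= size w)%N -> (0 <= h%:Z + height w k <= m%:Z)%R)
          (walk_le m h w).
Proof.
elim: w h => [|s w IHw] h hm.
  rewrite /= height0 addr0; apply: (iffP eqP) => [->|[]]; last by case.
  by split=> // -[|k] //; rewrite height0.
have step_cases h' : h%:Z + step_val s = h'%:Z -> (h' <= m)%N ->
    reflect (h%:Z + height (s :: w) (size (s :: w)) = 0 /\
      forall k, (k <= size (s :: w))%N ->
        (0 <= h%:Z + height (s :: w) k <= m%:Z)%R) (walk_le m h' w).
  move=> hE h'm; apply: (iffP (IHw h' h'm)) => -[H0 Hk]; split.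
  - by rewrite height_cons addrA hE.
  - move=> [_|k]; first by rewrite height0 addr0; lia.
    by rewrite ltnS height_cons addrA hE => /Hk.
  - by move: H0; rewrite height_cons addrA hE.
  - move=> k kw; have := Hk k.+1 kw.
    by rewrite height_cons addrA hE.
(* A first step that leaves the strip already violates the bounds at [k = 1]. *)
have out : (h%:Z + step_val s < 0) || (m%:Z < h%:Z + step_val s) ->
    ~ (h%:Z + height (s :: w) (size (s :: w)) = 0 /\
      forall k, (k <= size (s :: w))%N ->
        (0 <= h%:Z + height (s :: w) k <= m%:Z)%R).
  move=> H [_ /(_ 1%N)]; rewrite height_cons height0 addr0 /= => /(_ isT).
  by lia.
case: s step_cases out => /= step_cases out.
- have [hm'|mh] := ltnP h m; first by apply: step_cases => //; lia.
  by apply: ReflectF; apply: out; lia.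
- by apply: step_cases => //; lia.
- case: h {IHw} hm step_cases out => [|h] hm step_cases out.
    by apply: ReflectF; apply: out.
  by apply: step_cases; lia.
Qed.

Lemma walk_le0E m w : walk_le m 0 w = motzkin w && height_le m w.
Proof.
apply/walk_leP/andP => // [[H0 Hk]|[/andP[/eqP H0]]].
  rewrite add0r in H0; split; first rewrite /motzkin H0 eqxx /=.
    by apply/(forall_heightP (fun z => 0 <= z)) => k /Hk; rewrite add0r; lia.
  by apply/(forall_heightP (fun z => z <= m%:Z)) => k /Hk; rewrite add0r; lia.
move=> /(forall_heightP (fun z => 0 <= z)) Hge.
move=> /(forall_heightP (fun z => z <= m%:Z)) Hle.
by rewrite add0r; split=> // k kw; rewrite add0r Hge ?Hle.
Qed.

Lemma height_le_size m w : (size w <= m)%N -> height_le m w.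
Proof.
move=> wm; apply/(forall_heightP (fun z => z <= m%:Z)) => k kw.
have step_sum (v : seq step) : (\sum_(s <- v) step_val s <= (size v)%:Z)%R.
  elim: v => [|s v IHv]; first by rewrite big_nil.
  move: IHv; rewrite big_cons; move: (\sum_(s <- v) _) => z.
  by case: s => /=; lia.
by have := step_sum (take k w); rewrite /height size_take_min; lia.
Qed.

(** * Walks weighted by their turns *)

Section WalkSeries.
Variable R : comUnitRingType.
Variables tp tv : R.

Definition turn (s s' : step) : R :=
  match s, s' with Up, Down => tp | Down, Up => tv | _, _ => 1 end.

(** Remembering the preceding step [s] makes the weight multiplicative along the word; [Flat] is the
    neutral choice. *)
Fixpoint turns (s : step) (w : seq step) : R :=
  if w is s' :: w' then turn s s' * turns s' w' else 1.

Lemma turns_headE s w :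
  turns s w = turn s (head Flat w) * (tp ^+ peak w * tv ^+ valley w).
Proof.
elim: w s => [|s' w IHw] s.
  by rewrite /peak /valley /occ2 /= !expr0 !mulr1; case: s.
rewrite /= IHw; congr (_ * _).
case: w {IHw} => [|s'' w] /=.
  by rewrite /peak /valley /occ2 /= !expr0 !mulr1; case: s'.
rewrite /peak /valley /occ2 /= !exprD.
rewrite mulrACA; congr (_ * _).
by case: s'; case: s''; do 2 case: eqP => //; rewrite /= ?mul1r ?mulr1.
Qed.

Lemma turnsE w : turns Flat w = tp ^+ peak w * tv ^+ valley w.
Proof. by rewrite turns_headE mul1r. Qed.

Definition walk_sum m n h s : R :=
  \sum_(w : n.-tuple step | walk_le m h w) turns s w.

Lemma big_step (F : step -> R) : \sum_s F s = F Up + F Flat + F Down.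
Proof.
rewrite (bigD1 Up) // (bigD1 Flat) /=; last by apply/eqP.
rewrite (bigD1 Down) /=; last by apply/andP; split; apply/eqP.
by rewrite big1 ?addr0 ?addrA // => -[]; rewrite !eqxx ?andbF.
Qed.

Lemma big_tuple_cons n (P : pred (seq step)) (F : seq step -> R) :
  \sum_(w : n.+1.-tuple step | P w) F w =
  \sum_s \sum_(w : n.-tuple step | P (s :: w)) F (s :: w).
Proof.
rewrite pair_big_dep /=.
rewrite (reindex (fun sw : step * n.-tuple step => [tuple of sw.1 :: sw.2])) //.
exists (fun w : n.+1.-tuple step => (thead w, [tuple of behead w])) => w _.
  by rewrite theadE; case: w => s w /=; congr (_, _); apply: val_inj.
by rewrite -tuple_eta.
Qed.

Lemma walk_sum0 m h s : walk_sum m 0 h s = (h == 0%N)%:R.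
Proof.
rewrite /walk_sum big_mkcond (big_pred1 [tuple]) => [/=|w].
  by case: (h == 0%N).
by rewrite [w]tuple0; apply/esym/eqP.
Qed.

Lemma walk_sumS m n h s : walk_sum m n.+1 h s =
  (if (h < m)%N then turn s Up * walk_sum m n h.+1 Up else 0)
  + walk_sum m n h Flat
  + (if h is h'.+1 then turn s Down * walk_sum m n h' Down else 0).
Proof.
rewrite /walk_sum (big_tuple_cons n (walk_le m h) (turns s)) big_step /=.
congr (_ + _ + _).
- case: ifP => _ /=; last by rewrite big_pred0.
  by rewrite big_distrr.
- by apply: eq_bigr => w _; case: s; rewrite /= mul1r.
- by case: h => [|h]; [rewrite big_pred0 | rewrite big_distrr].
Qed.

Let X : fps R := fpsX.
Let p : fps R := fpsC tp - 1.
Let q : fps R := fpsC tv - 1.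

(* [a] is the generating function of one arch [U ... D]. *)
Definition path_gf (a : fps R) : fps R := (1 - X - a / (1 - q * a))^-1.

(** Arches of height at most [k]. The summand [p] corrects the arch with empty interior, a peak of
    weight [tp] instead of 1. *)
Fixpoint arch_gf (k : nat) : fps R :=
  if k is k'.+1 then X ^+ 2 * (path_gf (arch_gf k') + p) else 0.

Definition path_le_gf k := path_gf (arch_gf k).

(** After [Down] an initial arch creates a valley, of weight [tv = 1 + q]. The term 1 gives an
    ordinary path; the term [q] gives an arch followed again by a path after [Down]. Solving this
    equation yields the quotient. *)
Definition path_le_after_gf k (s : step) : fps R :=
  if s is Down then path_le_gf k / (1 - q * arch_gf k) else path_le_gf k.

Lemma fcoef0_arch_gf k : fcoef (arch_gf k) 0 = 0.
Proof. by case: k => [|k] //; rewrite [arch_gf _]/= exprS -mulrA fcoefXM0. Qed.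

Lemma fcoef0_arch_den k : fcoef (1 - q * arch_gf k) 0 = 1.
Proof.
by rewrite fcoefD fcoefN fcoefM0 fcoef0_arch_gf mulr0 subr0 fcoef1.
Qed.

Lemma fcoef0_path_le_gf_den k :
  fcoef (1 - X - arch_gf k / (1 - q * arch_gf k)) 0 = 1.
Proof.
rewrite !fcoefD !fcoefN fcoefM0 fcoef0_arch_gf mul0r subr0 fcoef1 /= coefX.
by rewrite subr0.
Qed.

Lemma fcoef0_path_le_gf k : fcoef (path_le_gf k) 0 = 1.
Proof. exact/fcoefV1/fcoef0_path_le_gf_den. Qed.

Lemma path_le_gfE k :
  path_le_gf k = 1 + X * path_le_gf k + arch_gf k * path_le_after_gf k Down.
Proof.
have /mulVr : 1 - X - arch_gf k / (1 - q * arch_gf k) \is a GRing.unit.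
  exact/unit_fcoef1/fcoef0_path_le_gf_den.
rewrite -/(path_gf _) -/(path_le_gf _) /= => E.
by rewrite -[Z in _ = Z + _ + _]E; ring.
Qed.

Lemma path_le_after_gf_DownE k : path_le_after_gf k Down =
  path_le_gf k + q * arch_gf k * path_le_after_gf k Down.
Proof.
have : path_le_after_gf k Down * (1 - q * arch_gf k) = path_le_gf k.
  by rewrite /= divrK //; apply/unit_fcoef1/fcoef0_arch_den.
by move=> E; rewrite -[Z in _ = Z + _]E; ring.
Qed.

(* First passage one level down, after a step [s], staying at most [k] above
   the starting level. *)
Definition descent_gf k (s : step) : fps R :=
  X * (path_le_after_gf k s + (if s is Up then p else 0)).

(* Walks from height [h] to 0 following a step [s] and staying in [0, m]. *)
Fixpoint walk_gf m h (s : step) : fps R :=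
  if h is h'.+1 then descent_gf (m - h'.+1) s * walk_gf m h' Down
  else path_le_after_gf m s.

(** The first-step system. It follows from splitting a path into the empty one, a flat step or an
    arch, followed by the rest ([path_le_gfE]). *)
Lemma walk_gfE m h s : (h <= m)%N -> walk_gf m h s = (h == 0%N)%:R + X *
  ((if (h < m)%N then fpsC (turn s Up) * walk_gf m h.+1 Up else 0)
   + walk_gf m h Flat
   + (if h is h'.+1 then fpsC (turn s Down) * walk_gf m h' Down else 0)).
Proof.
move=> hm.
(* The step up and the first return to level [h] form an arch; at [h = m] both sides vanish because
   [arch_gf 0 = 0]. *)
have up c : X * (if (h < m)%N then c * walk_gf m h.+1 Up else 0) =
    c * arch_gf (m - h) * walk_gf m h Down.
  have [hm'|mh] := ltnP h m; last first.
    by rewrite (eqP (_ : m - h == 0)%N) ?subn_eq0 //= !mulr0 mul0r.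
  rewrite (_ : m - h = (m - h.+1).+1)%N; last by lia.
  rewrite [walk_gf m h.+1 Up]/= /descent_gf /= -/(path_le_gf _).
  rewrite expr2; ring.
have tp1 : fpsC tp = 1 + p by rewrite addrC subrK.
have tv1 : fpsC tv = 1 + q by rewrite addrC subrK.
rewrite !mulrDr up.
move: (path_le_gfE (m - h)) (path_le_after_gf_DownE (m - h)).
case: h hm {up} => [|h] hm; rewrite ?subn0 ?eqxx /=.
  rewrite /path_le_after_gf.
  move: (path_le_gf m) (path_le_gf m / _) => A D EA ED.
  case: s => /=; rewrite ?fpsC1 ?tv1 mulr0 addr0; last rewrite {1}ED.
  - by rewrite {1}EA; ring.
  - by rewrite {1}EA; ring.
  - by rewrite {1}EA; ring.
rewrite /descent_gf /path_le_after_gf.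
move: (path_le_gf _) (path_le_gf _ / _) (walk_gf m h Down) => A D W EA ED.
case: s => /=; rewrite ?fpsC1 ?tv1 ?tp1 ?addr0; last rewrite {1}ED.
- by rewrite {1}EA; ring.
- by rewrite {1}EA; ring.
- by rewrite {1}EA; ring.
Qed.

(** The factor [X] in [walk_gfE] expresses degree [n.+1] through degree [n], so the system has only
    one solution. *)
Lemma fcoef_walk_gf m n h s : (h <= m)%N ->
  fcoef (walk_gf m h s) n = walk_sum m n h s.
Proof.
elim: n h s => [|n IHn] h s hm; rewrite walk_gfE // fcoefD.
  by rewrite fcoefXM0 walk_sum0 addr0; case: eqP.
have -> : fcoef (h == 0%N)%:R n.+1 = 0 :> R by case: eqP.
rewrite add0r fcoefXMS walk_sumS !fcoefD IHn //; congr (_ + _ + _).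
  by case: ifP => hm' //; rewrite fcoefCM IHn.
by case: h hm => [|h] hm //; rewrite fcoefCM IHn // ltnW.
Qed.

Lemma fcoef_path_le_gf m n : fcoef (path_le_gf m) n =
  \sum_(w in motzkin_paths_le m n) tp ^+ peak w * tv ^+ valley w.
Proof.
rewrite -[path_le_gf m]/(walk_gf m 0 Flat) fcoef_walk_gf //.
apply: eq_big => [w|w _]; last exact: turnsE.
by rewrite inE walk_le0E.
Qed.

(** * The homography and its fixed point *)

Let Di : fps R := (1 - X ^+ 2 * p * q)^-1.
Definition c1 : fps R := X ^+ 2 * p * Di.
Definition c2 : fps R := X ^+ 2 * q * Di.
Definition c3 : fps R := X ^+ 3 * p * q * Di.

Lemma fcoef0_den : fcoef (1 - X ^+ 2 * p * q) 0 = 1.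
Proof. by rewrite fcoefD fcoefN exprS -!mulrA fcoefXM0 subr0. Qed.

Lemma fcoef0_c1 : fcoef c1 0 = 0.
Proof. by rewrite /c1 exprS -!mulrA fcoefXM0. Qed.

Lemma fcoef0_c2 : fcoef c2 0 = 0.
Proof. by rewrite /c2 exprS -!mulrA fcoefXM0. Qed.

Lemma fcoef0_1X : fcoef (1 - X) 0 = 1.
Proof. by rewrite fcoefD fcoefN fcoef1 /= coefX subr0. Qed.

Lemma fcoef0_first : fcoef (1 - X - c1) 0 = 1.
Proof. by rewrite fcoefD fcoefN fcoef0_1X fcoef0_c1 subr0. Qed.

Lemma fcoef0_inner : fcoef (1 - X - c1 - c2) 0 = 1.
Proof. by rewrite fcoefD fcoefN fcoef0_first fcoef0_c2 subr0. Qed.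

Lemma fcoef0_last : fcoef (1 - X - c2) 0 = 1.
Proof. by rewrite fcoefD fcoefN fcoef0_1X fcoef0_c2 subr0. Qed.

Lemma Xc3E : X + c3 = X * Di.
Proof.
have DD : (1 - X ^+ 2 * p * q) * Di = 1.
  exact/divrr/unit_fcoef1/fcoef0_den.
by rewrite /c3 -{1}[X]mulr1 -DD; ring.
Qed.

Lemma sqXc3M f : (X + c3) ^+ 2 * f = X * (Di * (X * Di) * f).
Proof. by rewrite Xc3E; ring. Qed.

Lemma fcoef0_sqXc3 : fcoef ((X + c3) ^+ 2) 0 = 0.
Proof. by rewrite -[_ ^+ 2]mulr1 sqXc3M fcoefXM0. Qed.

(** Inverses are replaced by letters subject to their defining relations, which leaves polynomial
    identities: [u] is [1 / A], [y ^+ 2 * b * d] is [c2], and [v] is [1 / (u - c2)]. *)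
Lemma arch_ratio (S : comNzRingType) (y a b A u d v : S) :
  d * (1 - y ^+ 2 * a * b) = 1 -> u * A = 1 ->
  v * (u - y ^+ 2 * b * d) = 1 ->
  y ^+ 2 * (A + a) = (1 - b * (y ^+ 2 * (A + a))) *
     (y ^+ 2 * a * d + (y * d) ^+ 2 * v).
Proof.
move=> Hd Hu Hv.
set D := 1 - y ^+ 2 * a * b in Hd.
(* This factorization exposes the factor that cancels [v]. *)
have -> : 1 - b * (y ^+ 2 * (A + a)) = D * A * (u - y ^+ 2 * b * d).
  have -> : D * A * (u - y ^+ 2 * b * d) =
     D * (u * A) - y ^+ 2 * b * A * (d * D) by ring.
  by rewrite Hd Hu /D; ring.
have -> : D * A * (u - y ^+ 2 * b * d) * (y ^+ 2 * a * d + (y * d) ^+ 2 * v) =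
    (y ^+ 2 * a) * (d * D) * (u * A) - y ^+ 4 * b * a * d * (d * D) * A
    + y ^+ 2 * d * (d * D) * A * (v * (u - y ^+ 2 * b * d)) by ring.
have dE : d = 1 + y ^+ 2 * a * b * d by rewrite -[Z in _ = Z + _]Hd /D; ring.
by rewrite Hd Hu Hv !mulr1 {2}dE; ring.
Qed.

Lemma divr_path_le_gf k : path_le_gf k * (path_le_gf k)^-1 = 1.
Proof. exact/divrr/unit_fcoef1/fcoef0_path_le_gf. Qed.

Lemma fcoef0_path_le_gfV_c2 k : fcoef ((path_le_gf k)^-1 - c2) 0 = 1.
Proof.
rewrite fcoefD fcoefN fcoef0_c2 subr0 fcoefV1 //.
exact: fcoef0_path_le_gf.
Qed.

(** [arch_ratio] evaluates the quotient [a / (1 - q * a)] in [path_gf] at the next arch series. *)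
Lemma path_le_gfVS k : (path_le_gf k.+1)^-1 =
  1 - X - c1 - (X + c3) ^+ 2 / ((path_le_gf k)^-1 - c2).
Proof.
have aE : arch_gf k.+1 = (1 - q * arch_gf k.+1) *
    (c1 + (X + c3) ^+ 2 / ((path_le_gf k)^-1 - c2)).
  rewrite Xc3E /=; apply: arch_ratio.
  - exact/mulVr/unit_fcoef1/fcoef0_den.
  - by rewrite mulrC; apply: divr_path_le_gf.
  - exact/mulVr/unit_fcoef1/fcoef0_path_le_gfV_c2.
rewrite invrK {1}aE mulrAC divrr ?mul1r; last exact/unit_fcoef1/fcoef0_arch_den.
by rewrite opprD addrA.
Qed.

Lemma path_le_gfVS_c2 k : (path_le_gf k.+1)^-1 - c2 =
  1 - X - c1 - c2 - (X + c3) ^+ 2 / ((path_le_gf k)^-1 - c2).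
Proof. by rewrite path_le_gfVS addrAC. Qed.

Lemma path_le_gfV0 : (path_le_gf 0)^-1 = 1 - X.
Proof. by rewrite invrK /= mul0r subr0. Qed.

(** * The unbounded series and the periodic continued fraction *)

Section Limit.
Variable F : fps R.
Hypothesis F_lim : forall m, eqmodX m.+1 F (path_le_gf m).

Lemma fcoef0_limit : fcoef F 0 = 1.
Proof. by rewrite (F_lim (m := 0)) // fcoef0_path_le_gf. Qed.

Lemma fcoef0_limitV_c2 : fcoef (F^-1 - c2) 0 = 1.
Proof.
by rewrite fcoefD fcoefN fcoef0_c2 subr0 fcoefV1 // fcoef0_limit.
Qed.

Lemma eqmodX_limitV m : eqmodX m.+1 F^-1 (path_le_gf m)^-1.
Proof.
apply: eqmodXV; last exact: F_lim.
  exact/unit_fcoef1/fcoef0_limit.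
exact/unit_fcoef1/fcoef0_path_le_gf.
Qed.

Lemma limit_gfV : F^-1 = 1 - X - c1 - (X + c3) ^+ 2 / (F^-1 - c2).
Proof.
apply: eqmodX_eq => n k kn.
(* At level [n.+1], one use of the homography leads to level [n], which still agrees with [F] below
   degree [n]. *)
rewrite (eqmodX_limitV (m := n.+1)) 1?path_le_gfVS; last by lia.
apply/esym; move: k kn.
apply: eqmodXB => //; apply: eqmodXM => //; apply: eqmodXV.
- exact/unit_fcoef1/fcoef0_limitV_c2.
- exact/unit_fcoef1/fcoef0_path_le_gfV_c2.
- by apply: eqmodXB => // k kn; apply: eqmodX_limitV; lia.
Qed.

Lemma limit_gfV_c2 : F^-1 - c2 =
  1 - X - c1 - c2 - (X + c3) ^+ 2 / (F^-1 - c2).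
Proof. by rewrite {1}limit_gfV addrAC. Qed.

(** Truncations of the infinite fraction. They differ from the tails for bounded height, whose
    innermost denominator is [1 - X - c2]. *)
Fixpoint periodic_gf n : fps R :=
  if n is n'.+1 then (X + c3) ^+ 2 / (1 - X - c1 - c2 - periodic_gf n')
  else 0.

Lemma fcoef0_periodic_gf n : fcoef (periodic_gf n) 0 = 0.
Proof. by case: n => // n; rewrite [periodic_gf _]/= sqXc3M fcoefXM0. Qed.

Lemma fcoef0_periodic_den n : fcoef (1 - X - c1 - c2 - periodic_gf n) 0 = 1.
Proof.
by rewrite fcoefD fcoefN fcoef0_inner fcoef0_periodic_gf subr0.
Qed.

Lemma fcoef0_periodic_first n : fcoef (1 - X - c1 - periodic_gf n) 0 = 1.
Proof.
by rewrite fcoefD fcoefN fcoef0_first fcoef0_periodic_gf subr0.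
Qed.

(** The limit is a fixed point of the map being iterated, and [sqXc3M] supplies the factor [X] that
    makes this map contracting. *)
Lemma eqmodX_periodic n :
  eqmodX n (periodic_gf n) ((X + c3) ^+ 2 / (F^-1 - c2)).
Proof.
elim: n => // n IHn; rewrite [periodic_gf _]/= !sqXc3M; apply: eqmodX_shift.
apply: eqmodXM => //; apply: eqmodXV.
- exact/unit_fcoef1/fcoef0_periodic_den.
- exact/unit_fcoef1/fcoef0_limitV_c2.
- by rewrite limit_gfV_c2; apply: eqmodXB.
Qed.

Lemma eqmodX_limit n : eqmodX n (1 - X - c1 - periodic_gf n)^-1 F.
Proof.
rewrite -[Z in eqmodX _ _ Z]invrK; apply: eqmodXV.
- exact/unit_fcoef1/fcoef0_periodic_first.
- by rewrite unitrV; apply/unit_fcoef1/fcoef0_limit.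
- by rewrite limit_gfV; apply: eqmodXB => //; apply: eqmodX_periodic.
Qed.

(* [2 (F^-1 - c2) - (1 - X - c1 - c2)] is the square root of the discriminant
   of the quadratic equation [limit_gfV_c2] for [F^-1 - c2]. *)
Lemma limit_gf_discr :
  (F^-1 *+ 2 - (1 - X - c1 + c2)) ^+ 2 =
  (1 - X - c1 - c2) ^+ 2 - 4%:R * (X + c3) ^+ 2.
Proof.
have sE : (X + c3) ^+ 2 = (F^-1 - c2) * (1 - X - c1 - F^-1).
  rewrite [in Z in _ * Z]limit_gfV subKr mulrCA divrr ?mulr1 //.
  exact/unit_fcoef1/fcoef0_limitV_c2.
by rewrite sE; ring.
Qed.

(** Singles out the branch taken by [fps_sqrt]. *)
Lemma fcoef0_limit_discr : fcoef (F^-1 *+ 2 - (1 - X - c1 + c2)) 0 = 1.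
Proof.
rewrite mulr2n !(fcoefD, fcoefN) fcoef0_c1 fcoef0_c2 fcoefV1 ?fcoef0_limit //.
by rewrite fcoef1 /= coefX subr0 subr0 addr0 addrK.
Qed.

Lemma limit_gfE : 2%:R \is a @GRing.unit R ->
  F = 2%:R / (1 - X - c1 + c2 + (F^-1 *+ 2 - (1 - X - c1 + c2))).
Proof.
(* Invertibility of a series is that of its constant term, here 2 by computation. *)
move=> U2; have {}U2 : 2%:R \is a @GRing.unit (fps R) by [].
have FU : F \is a GRing.unit by exact/unit_fcoef1/fcoef0_limit.
rewrite [_ + (_ - _)]addrC subrK -[F^-1 *+ 2]mulr_natl invrM ?unitrV //.
by rewrite invrK mulrCA divrr ?mulr1.
Qed.

End Limit.

End WalkSeries.

(** * Continued fractions of rational functions *)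

Section ContinuedFraction.
Variables (K : fieldType) (e s b : K) (r : nat -> K).
Hypothesis r0 : r 0 = 1.
Hypothesis r1 : r 1 = e.
Hypothesis rSS : forall m, r m.+2 = b * r m.+1 - s * r m.
Hypothesis r_neq0 : forall m, r m != 0.

Lemma divr_shift (a c d : K) : d != 0 -> 1 / (a - c / d) = d / (a * d - c).
Proof.
move=> d0; rewrite (_ : a - c / d = (a * d - c) / d) ?invf_div ?mul1r //.
by rewrite mulrBl mulfK.
Qed.

Lemma contfrac_tail m :
  contfrac (nseq m (s, b) ++ [:: (s, e)]) = s * r m / r m.+1.
Proof.
elim: m => [|m IHm]; first by rewrite /= subr0 r0 r1 mulr1.
rewrite [LHS]/= -/(contfrac _) IHm -[LHS]mulr1 mulrAC -mulrA divr_shift //.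
by rewrite rSS mulrA.
Qed.

Lemma contfrac_ratio a m :
  contfrac ((1, a) :: nseq m (s, b) ++ [:: (s, e)]) =
  r m.+1 / (a * r m.+1 - s * r m).
Proof. by rewrite [LHS]/= -/(contfrac _) contfrac_tail divr_shift. Qed.

End ContinuedFraction.

(** * Expansions of the rational functions of the theorem *)

Local Notation c1' := (c1 t1_ t2_).
Local Notation c2' := (c2 t1_ t2_).
Local Notation c3' := (c3 t1_ t2_).
Local Notation gf := (path_le_gf t1_ t2_).

Lemma expands_x : expands x fpsX.
Proof. exact: expands_tofrac. Qed.

Lemma expands_t1B1 : expands (t1 - 1) (fpsC t1_ - 1).
Proof. by apply: expandsB (expands1 _); apply: expands_tofrac. Qed.

Lemma expands_t2B1 : expands (t2 - 1) (fpsC t2_ - 1).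
Proof. by apply: expandsB (expands1 _); apply: expands_tofrac. Qed.

Lemma expands_denV : expands (1 - x ^+ 2 * (t1 - 1) * (t2 - 1))^-1
  (1 - fpsX ^+ 2 * (fpsC t1_ - 1) * (fpsC t2_ - 1))^-1.
Proof.
apply: expandsV; first exact/unit_fcoef1/fcoef0_den.
apply: expandsB (expands1 _) _; apply: expandsM expands_t2B1.
exact: expandsM (expandsX 2 expands_x) expands_t1B1.
Qed.

Lemma expands_C1 : expands C1 c1'.
Proof.
apply: expandsM expands_denV.
exact: expandsM (expandsX 2 expands_x) expands_t1B1.
Qed.

Lemma expands_C2 : expands C2 c2'.
Proof.
apply: expandsM expands_denV.
exact: expandsM (expandsX 2 expands_x) expands_t2B1.
Qed.

Lemma expands_C3 : expands C3 c3'.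
Proof.
apply: expandsM expands_denV; apply: expandsM expands_t2B1.
exact: expandsM (expandsX 3 expands_x) expands_t1B1.
Qed.

Lemma expands_sqxC3 : expands ((x + C3) ^+ 2) ((fpsX + c3') ^+ 2).
Proof. exact: expandsX (expandsD expands_x expands_C3). Qed.

Lemma expands_1x : expands (1 - x) (1 - fpsX).
Proof. exact: expandsB (expands1 _) expands_x. Qed.

Lemma expands_first : expands (1 - x - C1) (1 - fpsX - c1').
Proof. exact: expandsB expands_1x expands_C1. Qed.

Lemma expands_inner : expands (1 - x - C1 - C2) (1 - fpsX - c1' - c2').
Proof. exact: expandsB expands_first expands_C2. Qed.

(** Gives [R_neq0]. The recurrence keeps the constant term 1 because [(x + C3) ^+ 2] vanishes at
    [x = 0]. *)
Lemma expands_R m : exists2 r, expands (R_ m) r & fcoef r 0 = 1.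
Proof.
suff: (exists2 r, expands (R_ m) r & fcoef r 0 = 1) /\
      (exists2 r, expands (R_ m.+1) r & fcoef r 0 = 1) by case.
elim: m => [|m [[r Er r1] [r' Er' r'1]]].
  split; first by exists 1; [apply: expands1 | rewrite fcoef1].
  exists (1 - fpsX - c2'); first exact: expandsB expands_1x expands_C2.
  exact: fcoef0_last.
split; first by exists r'.
exists ((1 - fpsX - c1' - c2') * r' - (fpsX + c3') ^+ 2 * r).
  exact: expandsB (expandsM expands_inner Er') (expandsM expands_sqxC3 Er).
rewrite fcoefD fcoefN fcoefM0 [X in _ - X]fcoefM0 fcoef0_sqXc3.
rewrite mul0r subr0 r'1 mulr1.
exact: fcoef0_inner.
Qed.

Lemma R_neq0 m : R_ m != 0.
Proof.
have [r /expands_neq0 Er r1] := expands_R m; apply: Er.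
apply: contra_eq_neq r1 => ->; rewrite fcoef0; rewrite eq_sym; exact: oner_neq0.
Qed.

(** The innermost denominator comes from [(gf 0)^-1 = 1 - X]; every level above it is one use of the
    homography. *)
Lemma expands_contfrac_tail m :
  expands (contfrac (nseq m ((x + C3) ^+ 2, 1 - x - C1 - C2)
                       ++ [:: ((x + C3) ^+ 2, 1 - x - C2)]))
          ((fpsX + c3') ^+ 2 / ((gf m)^-1 - c2')).
Proof.
elim: m => [|m IHm]; rewrite [contfrac _]/= -?/(contfrac _);
    apply: expandsM expands_sqxC3 _; apply: expandsV;
    try exact/unit_fcoef1/fcoef0_path_le_gfV_c2.
  rewrite subr0 path_le_gfV0; exact: expandsB expands_1x expands_C2.
rewrite path_le_gfVS_c2; exact: expandsB expands_inner IHm.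
Qed.

Lemma expands_contfrac m :
  expands (contfrac ((1, 1 - x - C1)
             :: nseq m ((x + C3) ^+ 2, 1 - x - C1 - C2)
             ++ [:: ((x + C3) ^+ 2, 1 - x - C2)])) (gf m.+1).
Proof.
rewrite [contfrac _]/= -/(contfrac _) div1r -[gf _]invrK; apply: expandsV.
  by rewrite unitrV; apply/unit_fcoef1/fcoef0_path_le_gf.
rewrite path_le_gfVS; exact: expandsB expands_first (expands_contfrac_tail m).
Qed.

Lemma expands_periodic n :
  expands (contfrac (nseq n ((x + C3) ^+ 2, 1 - x - C1 - C2)))
          (periodic_gf t1_ t2_ n).
Proof.
elim: n => [|n IHn]; first exact: expands0.
apply: expandsM expands_sqxC3 _; apply: expandsV.
  exact/unit_fcoef1/fcoef0_periodic_den.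
exact: expandsB expands_inner IHn.
Qed.

Lemma Fpv_leE m : Fpv_le m = gf m.
Proof. by apply: fpsP => n; rewrite fcoef_path_le_gf. Qed.

Lemma Fpv_lim m : eqmodX m.+1 Fpv (gf m).
Proof.
move=> k km; rewrite fcoef_path_le_gf; apply: eq_bigl => w.
rewrite !inE; case: (motzkin w) => //=; apply/esym/height_le_size.
by rewrite size_tuple.
Qed.

Lemma unit2_Qt : 2%:R \is a @GRing.unit Qt.
Proof.
have -> : 2%:R = (2%:R : rat)%:MP_[2] :> Qt by rewrite rmorph_nat.
by apply: rmorph_unit.
Qed.

Theorem theorem15 :
  (forall m : nat, (1 <= m)%N ->
     Fpv_le m = expand (R_ m / ((1 - x - C1) * R_ m - (x + C3) ^+ 2 * R_ m.-1))
     /\ R_ m / ((1 - x - C1) * R_ m - (x + C3) ^+ 2 * R_ m.-1) =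
        contfrac ((1, 1 - x - C1)
                    :: nseq m.-1 ((x + C3) ^+ 2, 1 - x - C1 - C2)
                    ++ [:: ((x + C3) ^+ 2, 1 - x - C2)]))
  /\ fps_cvg (fun n => expand (contfrac ((1, 1 - x - C1)
                    :: nseq n ((x + C3) ^+ 2, 1 - x - C1 - C2)))) Fpv
  /\ Fpv = 2%:R / (expand (1 - x - C1 + C2)
             + fps_sqrt (expand ((1 - x - C1 - C2) ^+ 2 - 4%:R * (x + C3) ^+ 2))).
Proof.
split=> [[//|m] _|].
  have E := contfrac_ratio (K := Qxt) (r := R_) (erefl _) (erefl _)
    (fun=> erefl _) R_neq0 (1 - x - C1) m.
  split; last by rewrite E.
  by rewrite -E (expands_expand (expands_contfrac m)) Fpv_leE.
split.
  (* The truncation with [n] periodic levels is correct below degree [n], so coefficient [k] is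
     final from [n = k.+1] on. *)
  move=> k; exists k.+1 => n kn; rewrite [contfrac _]/= -/(contfrac _) div1r.
  rewrite (@expands_expand _ _ (1 - fpsX - c1' - periodic_gf t1_ t2_ n)^-1).
    exact: (eqmodX_limit Fpv_lim).
  apply: expandsV; first exact/unit_fcoef1/fcoef0_periodic_first.
  exact: expandsB expands_first (expands_periodic n).
rewrite (expands_expand (expandsD expands_first expands_C2)).
rewrite (expands_expand (expandsB (expandsX 2 expands_inner)
  (expandsM (expands_nat _ 4) expands_sqxC3))).
have nz2 : 2%:R != 0 :> Qt by apply: contraTneq unit2_Qt => ->; rewrite unitr0.
rewrite (fps_sqrtE nz2 (fcoef0_limit_discr Fpv_lim) (limit_gf_discr Fpv_lim)).
exact: (limit_gfE Fpv_lim unit2_Qt).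
Qed.
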